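(* Let $\Omega\subseteq\mathbb{H}\setminus\mathbb{R}$ be an open set and let $f:\Omega\to\mathbb{H}$ be a quaternionic function of class $C^{2}$ that can be written as $f(p)=u(p)+\iota(p)\, v(p)$, where $u,v:\Omega\to\mathbb{R}$ are real-valued functions, and that satisfies $$D_{l}f=\frac{-2v}{r}\quad\text{on }\Omega .$$ Then $$D_{l}\Delta f=D_{r}\Delta f=0\quad\text{on }\Omega .$$
   Context: $\mathbb{H}$ denotes the real quaternions with standard units $i,j,k$; a quaternion is written $p=t+xi+yj+zk$ with $t,x,y,z\in\mathbb{R}$, and $\mathbb{H}$ is identified with $\mathbb{R}^4$ for the purposes of differentiability. The real axis $\mathbb{R}\subset\mathbb{H}$ is the set where $x=y=z=0$. For $p\in\mathbb{H}\setminus\mathbb{R}$ put $$r=r(p)=\sqrt{x^2+y^2+z^2}>0,\qquad \iota=\iota(p)=\frac{xi+yj+zk}{\sqrt{x^2+y^2+z^2}},$$ so that $p=t+r\iota$ and $\iota^2=-1$. The functions $u,v$ may depend on all four variables $t,x,y,z$ (they are not assumed to depend only on $t$ and $r$). The left and right Fueter operators are $$D_{l}f=\frac{\partial f}{\partial t}+i\frac{\partial f}{\partial x}+j\frac{\partial f}{\partial y}+k\frac{\partial f}{\partial z},\qquad D_{r}f=\frac{\partial f}{\partial t}+\frac{\partial f}{\partial x}i+\frac{\partial f}{\partial y}j+\frac{\partial f}{\partial z}k,$$ and $\Delta=\frac{\partial^2}{\partial t^2}+\frac{\partial^2}{\partial x^2}+\frac{\partial^2}{\partial y^2}+\frac{\partial^2}{\partial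 z^2}$ is the Laplacian on $\mathbb{R}^4$ (applied componentwise). A function $g$ is called left-regular if $D_l g=0$ and right-regular if $D_r g=0$. *)

(* Defs.v *)
From HB Require Import structures.
From mathcomp Require Import all_boot all_order all_algebra.
From mathcomp Require Import all_classical all_reals all_analysis.
Set Implicit Arguments.
Unset Strict Implicit.
Unset Printing Implicit Defensive.
Import Order.TTheory GRing.Theory Num.Theory.
Import numFieldNormedType.Exports.
Local Open Scope classical_set_scope.
Local Open Scope ring_scope.

(* The quaternion t + x i + y j + z k is the row vector (t, x, y, z); H thus
   has the normed space structure of R^4, and its product is [qmul]. *)
Notation quat R := 'rV[R]_4.

Section Quaternions.
Variable R : realType.
Implicit Types (p q : quat R) (a t x y z : R).

Definition mkquat t x y z : quat R := \row_(l < 4) [:: t; x; y; z]`_l.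

Definition qt p : R := p ord0 (@Ordinal 4 0 isT).
Definition qx p : R := p ord0 (@Ordinal 4 1 isT).
Definition qy p : R := p ord0 (@Ordinal 4 2 isT).
Definition qz p : R := p ord0 (@Ordinal 4 3 isT).

Definition qreal a : quat R := mkquat a 0 0 0.
Definition q1 : quat R := mkquat 1 0 0 0.
Definition qi : quat R := mkquat 0 1 0 0.
Definition qj : quat R := mkquat 0 0 1 0.
Definition qk : quat R := mkquat 0 0 0 1.

Definition qmul p q : quat R :=
  mkquat (qt p * qt q - qx p * qx q - qy p * qy q - qz p * qz q)
         (qt p * qx q + qx p * qt q + qy p * qz q - qz p * qy q)
         (qt p * qy q - qx p * qz q + qy p * qt q + qz p * qx q)
         (qt p * qz q + qx p * qy q - qy p * qx q + qz p * qt q).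

Definition real_axis : set (quat R) :=
  [set p | [/\ qx p = 0, qy p = 0 & qz p = 0]].

Definition qr p : R := Num.sqrt (qx p ^+ 2 + qy p ^+ 2 + qz p ^+ 2).

Definition qiota p : quat R :=
  (qr p)^-1 *: (qx p *: qi + qy p *: qj + qz p *: qk).

End Quaternions.

Arguments q1 {R}.
Arguments qi {R}.
Arguments qj {R}.
Arguments qk {R}.
Arguments real_axis {R}.

Section Fueter.
Variable R : realType.
Implicit Types (f : quat R -> quat R) (p : quat R).

Definition Dleft f p : quat R :=
  'D_q1 f p + qmul qi ('D_qi f p) + qmul qj ('D_qj f p) + qmul qk ('D_qk f p).

Definition Dright f p : quat R :=
  'D_q1 f p + qmul ('D_qi f p) qi + qmul ('D_qj f p) qj + qmul ('D_qk f p) qk.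

Definition laplacian f p : quat R :=
  'D_q1 ('D_q1 f) p + 'D_qi ('D_qi f) p
  + 'D_qj ('D_qj f) p + 'D_qk ('D_qk f) p.

(* ['D_v f p] is a total operator, so the existence of the partial derivatives
   has to be asserted separately. *)
Definition has_partials f p : Prop :=
  [/\ derivable f p q1, derivable f p qi, derivable f p qj & derivable f p qk].

(* Class C^n on a set Omega meant to be open, so that continuity and partial
   derivatives at its points only involve the values of f on Omega. *)
Fixpoint Cn_on (n : nat) (Omega : set (quat R)) f : Prop :=
  (forall p, Omega p -> {for p, continuous f}) /\
  if n is m.+1 then
    (forall p, Omega p -> has_partials f p) /\
    [/\ Cn_on m Omega ('D_q1 f), Cn_on m Omega ('D_qi f),
        Cn_on m Omega ('D_qj f) & Cn_on m Omega ('D_qk f)]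
  else True.

(* Since a left- or right-regular function is one to which the operator
   applies, regularity includes the existence of the partial derivatives. *)
Definition left_regular (Omega : set (quat R)) f : Prop :=
  forall p, Omega p -> has_partials f p /\ Dleft f p = 0.

Definition right_regular (Omega : set (quat R)) f : Prop :=
  forall p, Omega p -> has_partials f p /\ Dright f p = 0.

End Fueter.

(* Main.v *)
Require Import Defs.
From mathcomp Require Import all_boot all_order all_algebra.
From mathcomp Require Import all_classical all_reals all_analysis.
From mathcomp Require Import ring lra.
Set Implicit Arguments.
Unset Strict Implicit.
Unset Printing Implicit Defensive.
Import Order.TTheory GRing.Theory Num.Theory.
Import numFieldNormedType.Exports.
Local Open Scope classical_set_scope.
Local Open Scope ring_scope.

(** Put X = xi + yj + zk and w = v / r.  Then f = u + X w, and w is again of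
    class C^2, being (x f_x + y f_y + z f_z) / r^2 ([smooth_radial_quotient]);
    working with w instead of v makes every coefficient below polynomial.
    Read componentwise, D_l f = -2 w is the first order system
      u_t = w + (x w_x + y w_y + z w_z),    grad u = cross(X, grad w) - w_t X
    where grad is the gradient in (x, y, z) and cross the vector product
    ([fueter_system_of_Dleft]).

    Differentiate it once more and eliminate the second derivatives of u, whose
    mixed ones are symmetric ([schwarz]): taking the divergence gives Lap u = -2 w_t, and
    the compatibility conditions u_ab = u_ba add up to X Lap w = 0, so that w
    is harmonic, X being nonzero off the real axis
    ([laplacians_of_fueter_system]).  Since Lap (X w) = X Lap w + 2 grad w,
      Lap f = -2 w_t + 2 grad w = -2 conj(D) w
    with conj(D) the conjugate of the Fueter operator
    ([laplacian_conj_gradient]).  This involves w only through its first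
    derivatives, so Lap f has partial derivatives although f is merely C^2;
    and D_l conj(D) w = D_r conj(D) w = Lap w = 0 because w is real valued
    ([conj_gradient_regular]). *)

(** * Symmetry of mixed directional derivatives *)

Section Schwarz.
Context {R : realType} {V : normedModType R}.
Implicit Types (g : V -> R) (p q v : V).

Lemma is_derive_line g q v (s : R) :
  derivable g (s *: v + q) v ->
  is_derive s 1 (fun s : R => g (s *: v + q)) ('D_v g (s *: v + q)).
Proof.
have E : (fun h => h^-1 *: (((fun s : R => g (s *: v + q)) \o shift s) (h *: 1)
      - g (s *: v + q))) =
    (fun h => h^-1 *: ((g \o shift (s *: v + q)) (h *: v) - g (s *: v + q))).
  by apply/funext => h /=; rewrite [h *: 1]mulr1 scalerDl addrA.
by move=> dg; split; rewrite /derivable /derive E.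
Qed.

Lemma is_derive_translate g a q v :
  derivable g (a + q) v ->
  is_derive q v (fun q => g (a + q)) ('D_v g (a + q)).
Proof.
have E : (fun h => h^-1 *: (((fun q => g (a + q)) \o shift q) (h *: v)
      - g (a + q))) =
    (fun h => h^-1 *: ((g \o shift (a + q)) (h *: v) - g (a + q))).
  by apply/funext => h /=; rewrite addrCA.
by move=> dg; split; rewrite /derivable /derive E.
Qed.

(* Keeps unification from comparing distinct derivatives as limits of distinct
   difference quotients, a search that does not end in practice. *)
Local Opaque derive derivable.

Lemma MVT_line g q v (h : R) : 0 < h ->
  (forall s, s \in `[0, h]%R -> derivable g (s *: v + q) v) ->
  exists2 s, s \in `]0, h[%R & g (h *: v + q) - g q = h * 'D_v g (s *: v + q).
Proof.
move=> h0 dg.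
have dl s : s \in `[0, h]%R ->
    is_derive s 1 (fun s : R => g (s *: v + q)) ('D_v g (s *: v + q)).
  by move=> sh; apply/is_derive_line/dg.
pose f (s : R) : R := g (s *: v + q).
pose df (s : R) : R := 'D_v g (s *: v + q).
have cf : {within `[0, h], continuous f}.
  apply: derivable_within_continuous => s /dl.
  by move=> sh; exact: (@ex_derive _ _ _ _ _ _ _ sh).
have fd s : s \in `]0, h[%R -> is_derive s 1 f (df s).
  by move=> sh; apply: dl; apply: subset_itv_oo_cc sh.
have := @MVT R f df 0 h h0 fd cf.
by rewrite /f /df scale0r add0r subr0 => -[s sh ->]; exists s; rewrite 1?mulrC.
Qed.

(** The mean value theorem is applied twice, first along [a] to the increment of
    [g] by [h *: b], then along [b] to ['D_a g]: the second difference, which is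
    symmetric in [a] and [b], is a value of either mixed derivative. *)
Lemma second_difference g p a b (h : R) : 0 < h ->
  (forall s t, s \in `[0, h]%R -> t \in `[0, h]%R ->
    derivable g (s *: a + t *: b + p) a /\
    derivable ('D_a g) (s *: a + t *: b + p) b) ->
  exists s t, [/\ s \in `]0, h[%R, t \in `]0, h[%R &
    g (h *: a + h *: b + p) - g (h *: a + p) - g (h *: b + p) + g p
    = h ^+ 2 * 'D_b ('D_a g) (s *: a + t *: b + p)].
Proof.
move=> h0 dg.
have h00 : 0 \in `[0, h]%R by rewrite in_itv /= lexx ltW.
have hh : h \in `[0, h]%R by rewrite in_itv /= lexx ltW.
pose G := (fun q => g (h *: b + q)) - g.
have dG s : s \in `[0, h]%R ->
    is_derive (s *: a + p) a (fun q => g (h *: b + q))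
      ('D_a g (h *: b + (s *: a + p))) /\
    derivable g (s *: a + p) a.
  move=> sh; split; last first.
    by have [+ _] := dg s 0 sh h00; rewrite scale0r addr0.
  apply: is_derive_translate; have [+ _] := dg s h sh hh.
  by rewrite addrA [h *: b + _]addrC.
have [|s sh] := @MVT_line G p a h h0.
  by move=> s /dG[[d1 _] d2]; exact: derivableB.
have sh' : s \in `[0, h]%R by apply: subset_itv_oo_cc sh.
have [d1 d2] := dG _ sh'.
rewrite (deriveB (@ex_derive _ _ _ _ _ _ _ d1) d2).
rewrite (@derive_val _ _ _ _ _ _ _ d1) => e1.
have [|t th e2] := @MVT_line ('D_a g) (s *: a + p) b h h0.
  by move=> t th; have [_] := dg s t sh' th; rewrite [s *: a + _]addrC -addrA.
exists s, t; split; [exact: sh|exact: th|].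
have <- : t *: b + (s *: a + p) = s *: a + t *: b + p by rewrite addrCA addrA.
rewrite expr2 -(mulrA h h) -e2 -e1 /G !fctE.
rewrite addrCA addrA; ring.
Qed.

(** The points where the two functions are compared may differ: the
    intermediate points produced by [second_difference] for the two orders of
    differentiation are unrelated. *)
Lemma eq_at_of_eq_nearby (F G : V -> R) p :
  {for p, continuous F} -> {for p, continuous G} ->
  (forall d : R, 0 < d -> exists q q', [/\ ball p d q, ball p d q' & F q = G q']) ->
  F p = G p.
Proof.
move=> cF cG FG; suff le (e : R) : 0 < e -> `|F p - G p| <= e.
  apply/eqP; rewrite -subr_eq0 -normr_le0.
  by apply/ler_addgt0Pr => e e0; rewrite add0r; exact: le.
move=> e0; have e20 : 0 < e / 2 by rewrite divr_gt0.
have nF : \forall q \near p, `|F p - F q| < e / 2.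
  by move/cvgrPdist_lt: cF; exact.
have nG : \forall q \near p, `|G p - G q| < e / 2.
  by move/cvgrPdist_lt: cG; exact.
have /nbhs_ballP[d /= d0 dP] : \forall q \near p,
    `|F p - F q| < e / 2 /\ `|G p - G q| < e / 2.
  exact: filterI nF nG.
have [q [q' [/dP[/= Fq _] /dP[/= _ Gq'] E]]] := FG d d0.
rewrite (le_trans (ler_distD (F q) _ _))// [e]splitr lerD ?(ltW Fq)//.
by rewrite E distrC ltW.
Qed.

Lemma schwarz (Omega : set V) g a b p : open Omega -> Omega p ->
  (forall q, Omega q -> [/\ derivable g q a, derivable g q b,
    derivable ('D_a g) q b & derivable ('D_b g) q a]) ->
  {for p, continuous ('D_b ('D_a g))} ->
  {for p, continuous ('D_a ('D_b g))} ->
  'D_b ('D_a g) p = 'D_a ('D_b g) p.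
Proof.
move=> oO Op dg cba cab; apply: eq_at_of_eq_nearby cba cab _ => d d0.
have /nbhs_ballP[r /= r0 rO] : \forall q \near p, Omega q.
  exact: open_nbhs_nbhs.
pose m := Num.min d r.
have m0 : 0 < m by rewrite lt_min d0.
(* Dividing by [N] makes the whole parallelogram of side [h] fit in the ball. *)
pose N := `|a| + `|b| + 1.
have N0 : 0 < N by rewrite ltr_wpDl// addr_ge0.
pose h := m / N / 2.
have h0 : 0 < h by rewrite !divr_gt0.
have inb s t : s \in `[0, h]%R -> t \in `[0, h]%R ->
    ball p m (s *: a + t *: b + p).
  rewrite !in_itv /= => /andP[s0 sh] /andP[t0 th].
  rewrite -ball_normE /= opprD addrCA subrr addr0 normrN.
  apply: le_lt_trans (ler_normD _ _) _; rewrite !normrZ !ger0_norm//.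
  apply: (@le_lt_trans _ _ (h * N)).
    rewrite /N !mulrDr -[leLHS]addr0 lerD// ?mulr1 ?(ltW h0)//.
    by rewrite lerD// ler_wpM2r.
  by rewrite /h mulrAC divfK ?gt_eqF// ltr_pdivrMr// ltr_pMr// ltr1n.
have hO s t : s \in `[0, h]%R -> t \in `[0, h]%R -> Omega (s *: a + t *: b + p).
  move=> sh th; apply: rO; apply: le_ball (inb _ _ sh th).
  by rewrite ge_min lexx orbT.
have hd s t : s \in `]0, h[%R -> t \in `]0, h[%R ->
    ball p d (s *: a + t *: b + p).
  move=> /subset_itv_oo_cc sh /subset_itv_oo_cc th.
  by apply: le_ball (inb _ _ sh th); rewrite ge_min lexx.
have [|s [t [sh th e1]]] := @second_difference g p a b h h0.
  by move=> s t sh th; have [da _ dab _] := dg _ (hO _ _ sh th); exact (conj da dab).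
have [|t' [s' [th' sh' e2]]] := @second_difference g p b a h h0.
  move=> t' s' th' sh'; rewrite [t' *: b + _]addrC.
  have [_ db _ dba] := dg _ (hO _ _ sh' th'); exact (conj db dba).
exists (s *: a + t *: b + p), (s' *: a + t' *: b + p); split.
- exact: hd.
- exact: hd.
apply: (mulfI (_ : h ^+ 2 != 0)); first by rewrite expf_neq0 ?gt_eqF.
rewrite [t' *: b + _]addrC [h *: b + _]addrC in e2.
by apply: etrans (esym e1) (etrans _ e2); ring.
Qed.
End Schwarz.

(** * Scalar functions of class C^n along a family of directions *)

Section PartialSmoothness.
Context {R : realType} {V : normedModType R} {I : Type} (e : I -> V).
Implicit Types (g h : V -> R) (Omega : set V).

(** Scalar counterpart of [Cn_on].  As the directions form a family, one
    induction on [n] settles each closure property below. *)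
Fixpoint smooth (n : nat) Omega g : Prop :=
  (forall p, Omega p -> {for p, continuous g}) /\
  if n is m.+1 then
    forall i, (forall p, Omega p -> derivable g p (e i)) /\
      smooth m Omega ('D_(e i) g)
  else True.

Lemma near_of_open Omega (P : V -> Prop) p : open Omega ->
  (forall q, Omega q -> P q) -> Omega p -> \forall q \near p, P q.
Proof.
move=> oO OP Op; have nO : \forall q \near p, Omega q by exact: open_nbhs_nbhs.
exact: filterS nO.
Qed.

Lemma continuous_for_eq_on (W : normedModType R) Omega (g h : V -> W) p :
  open Omega -> (forall q, Omega q -> g q = h q) -> Omega p ->
  {for p, continuous g} -> {for p, continuous h}.
Proof.
move=> oO gh Op cg; rewrite /prop_for /continuous_at -(gh _ Op).
apply: cvg_trans cg; apply: near_eq_cvg.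
exact: near_of_open gh Op.
Qed.

Lemma is_derive_eq_on (W : normedModType R) Omega (g h : V -> W) p v dg :
  open Omega -> (forall q, Omega q -> g q = h q) -> Omega p ->
  is_derive p v h dg -> is_derive p v g dg.
Proof.
move=> oO gh Op; apply: near_eq_is_derive.
by apply: (near_of_open oO) Op => q /gh.
Qed.

Lemma smooth_eq_on n Omega g h : open Omega ->
  (forall q, Omega q -> g q = h q) -> smooth n Omega g -> smooth n Omega h.
Proof.
move=> oO; elim: n g h => [|n IH] g h gh /= [cg dg]; split => //.
- by move=> p Op; apply: continuous_for_eq_on gh Op (cg _ Op).
- by move=> p Op; apply: continuous_for_eq_on gh Op (cg _ Op).
move=> i; have [dgi sgi] := dg i.
have dh p : Omega p -> is_derive p (e i) h ('D_(e i) g p).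
  move=> Op; apply: (is_derive_eq_on oO) (Op) (derivableP (dgi _ Op)).
  by move=> q /gh.
split=> [p /dh[]//|]; apply: IH sgi => p Op.
by rewrite (@derive_val _ _ _ _ _ _ _ (dh p Op)).
Qed.

Lemma smoothW n Omega g : smooth n.+1 Omega g -> smooth n Omega g.
Proof.
elim: n g => [|n IH] g; first by case.
move=> [cg dg]; split=> // i; have [dgi sgi] := dg i.
by split=> //; apply: IH.
Qed.

Lemma smooth_cst n Omega (c : R) : open Omega -> smooth n Omega (cst c).
Proof.
move=> oO; elim: n c => [|n IH] c; split=> //; try by move=> p _; exact: cvg_cst.
move=> i; split=> [p _|]; first exact: derivable_cst.
by apply: smooth_eq_on (IH 0) => // p _; rewrite derive_cst.
Qed.

Lemma smoothD n Omega g h : open Omega ->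
  smooth n Omega g -> smooth n Omega h -> smooth n Omega (g + h).
Proof.
move=> oO; elim: n g h => [|n IH] g h [cg dg] [ch dh].
  by split=> // p Op; apply: cvgD; [exact: cg|exact: ch].
split=> [p Op|i]; first by apply: cvgD; [exact: cg|exact: ch].
have [dgi sgi] := dg i; have [dhi shi] := dh i; split=> [p Op|].
  by apply: derivableD; [exact: dgi|exact: dhi].
apply: smooth_eq_on (IH _ _ sgi shi) => // p Op.
by rewrite deriveD; [|exact: dgi|exact: dhi].
Qed.

(** Leibniz' rule expresses the derivative by products of functions that are
    one degree less smooth, hence the induction and [smoothW]. *)
Lemma smoothM n Omega g h : open Omega ->
  smooth n Omega g -> smooth n Omega h -> smooth n Omega (g * h).
Proof.
move=> oO; elim: n g h => [|n IH] g h sg sh; have [cg dg] := sg;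
  have [ch dh] := sh.
  by split=> // p Op; apply: cvgM; [exact: cg|exact: ch].
split=> [p Op|i]; first by apply: cvgM; [exact: cg|exact: ch].
have [dgi sgi] := dg i; have [dhi shi] := dh i; split=> [p Op|].
  by apply: derivableM; [exact: dgi|exact: dhi].
have := smoothD oO (IH _ _ (smoothW sg) shi) (IH _ _ (smoothW sh) sgi).
apply: smooth_eq_on => // p Op.
by rewrite deriveM; [|exact: dgi|exact: dhi].
Qed.

(** The derivative - g' * (1/g) * (1/g) is a product with factors 1/g, to which
    the induction hypothesis applies. *)
Lemma smoothV n Omega g : open Omega -> (forall p, Omega p -> g p != 0) ->
  smooth n Omega g -> smooth n Omega (fun p => (g p)^-1).
Proof.
move=> oO g0; elim: n => [|n IH] sg; have [cg dg] := sg.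
  by split=> // p Op; apply: cvgV; [exact: g0|exact: cg].
split=> [p Op|i]; first by apply: cvgV; [exact: g0|exact: cg].
have [dgi sgi] := dg i; split=> [p Op|].
  by apply: derivableV; [exact: g0|exact: dgi].
have sV := IH (smoothW sg).
have := smoothM oO (smoothM oO (smooth_cst n (-1) oO) sgi) (smoothM oO sV sV).
apply: smooth_eq_on => // p Op.
rewrite deriveV; [|exact: g0|exact: dgi].
by rewrite !fctE [RHS]mulNr mulN1r mulNr mulrC -invfM -expr2.
Qed.

Lemma smooth2_schwarz Omega g p i j : open Omega -> smooth 2 Omega g -> Omega p ->
  'D_(e j) ('D_(e i) g) p = 'D_(e i) ('D_(e j) g) p.
Proof.
move=> oO [_ dg] Op.
have [dgi [_ ddgi]] := dg i; have [dgj [_ ddgj]] := dg j.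
have [dgij [cgij _]] := ddgi j; have [dgji [cgji _]] := ddgj i.
apply: (schwarz oO Op) (cgij _ Op) (cgji _ Op) => q Oq.
exact (And4 (dgi _ Oq) (dgj _ Oq) (dgij _ Oq) (dgji _ Oq)).
Qed.

End PartialSmoothness.

(** * Quaternion coordinates *)

Local Notation ot := (@Ordinal 4 0 isT).
Local Notation ox := (@Ordinal 4 1 isT).
Local Notation oy := (@Ordinal 4 2 isT).
Local Notation oz := (@Ordinal 4 3 isT).

Section Coordinates.
Context {R : realType}.
Implicit Types (p q v : quat R) (f : quat R -> quat R) (Omega : set (quat R)).

Definition qbasis (l : 'I_4) : quat R := [:: q1; qi; qj; qk]`_l.
Definition qcoord (l : 'I_4) p : R := p ord0 l.

Lemma qtE a b c d : qt (mkquat a b c d : quat R) = a. Proof. by rewrite /qt mxE. Qed.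
Lemma qxE a b c d : qx (mkquat a b c d : quat R) = b. Proof. by rewrite /qx mxE. Qed.
Lemma qyE a b c d : qy (mkquat a b c d : quat R) = c. Proof. by rewrite /qy mxE. Qed.
Lemma qzE a b c d : qz (mkquat a b c d : quat R) = d. Proof. by rewrite /qz mxE. Qed.

Definition mkquatE := (qtE, qxE, qyE, qzE).

Lemma qtD p q : qt (p + q) = qt p + qt q. Proof. by rewrite /qt mxE. Qed.
Lemma qxD p q : qx (p + q) = qx p + qx q. Proof. by rewrite /qx mxE. Qed.
Lemma qyD p q : qy (p + q) = qy p + qy q. Proof. by rewrite /qy mxE. Qed.
Lemma qzD p q : qz (p + q) = qz p + qz q. Proof. by rewrite /qz mxE. Qed.
Lemma qtZ (c : R) p : qt (c *: p) = c * qt p. Proof. by rewrite /qt mxE. Qed.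
Lemma qxZ (c : R) p : qx (c *: p) = c * qx p. Proof. by rewrite /qx mxE. Qed.
Lemma qyZ (c : R) p : qy (c *: p) = c * qy p. Proof. by rewrite /qy mxE. Qed.
Lemma qzZ (c : R) p : qz (c *: p) = c * qz p. Proof. by rewrite /qz mxE. Qed.

Definition quat_linE := (qtD, qxD, qyD, qzD, qtZ, qxZ, qyZ, qzZ).

Lemma quatP p q : qt p = qt q -> qx p = qx q -> qy p = qy q -> qz p = qz q ->
  p = q.
Proof.
move=> et ex ey ez; apply/rowP => -[[|[|[|[|//]]]] k].
- by rewrite (bool_irrelevance k isT).
- by rewrite (bool_irrelevance k isT).
- by rewrite (bool_irrelevance k isT).
- by rewrite (bool_irrelevance k isT).
Qed.

Lemma qbasis_coordE :
  ((@qt R q1 = 1) * (@qt R qi = 0) * (@qt R qj = 0) * (@qt R qk = 0)) *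
  ((@qx R q1 = 0) * (@qx R qi = 1) * (@qx R qj = 0) * (@qx R qk = 0)) *
  ((@qy R q1 = 0) * (@qy R qi = 0) * (@qy R qj = 1) * (@qy R qk = 0)) *
  ((@qz R q1 = 0) * (@qz R qi = 0) * (@qz R qj = 0) * (@qz R qk = 1)).
Proof. by rewrite !mkquatE. Qed.

Lemma qbasis_indicator (l : 'I_4) :
  [/\ @qx R (qbasis l) = (l == ox)%:R, @qy R (qbasis l) = (l == oy)%:R &
   @qz R (qbasis l) = (l == oz)%:R].
Proof. by move: l => [[|[|[|[|//]]]] k]; rewrite /qbasis/= !qbasis_coordE. Qed.

Lemma derivable_comp_coord (g : quat R -> quat R) p v l :
  derivable g p v -> is_derive p v (fun q => qcoord l (g q)) (qcoord l ('D_v g p)).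
Proof.
move=> dg; split; first exact: (derivable_mxP _ _ _).1.
by rewrite derive_mx// /qcoord mxE.
Qed.

Lemma derivable_quat (g : quat R -> quat R) p v :
  (forall l, derivable (fun q => qcoord l (g q)) p v) -> derivable g p v.
Proof. by move=> dg; apply/derivable_mxP => i j; rewrite ord1; exact: dg. Qed.

Lemma is_derive_coord l p v : is_derive p v (qcoord l) (qcoord l v).
Proof.
have := @derivable_comp_coord id p v l (@derivable_id _ _ p v).
by rewrite derive_id.
Qed.

Lemma is_derive_qx p v : is_derive p v (@qx R) (qx v).
Proof. exact: is_derive_coord. Qed.
Lemma is_derive_qy p v : is_derive p v (@qy R) (qy v).
Proof. exact: is_derive_coord. Qed.
Lemma is_derive_qz p v : is_derive p v (@qz R) (qz v).
Proof. exact: is_derive_coord. Qed.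

Lemma smooth_coord n Omega l : open Omega -> smooth qbasis n Omega (qcoord l).
Proof.
move=> oO; have cc p : Omega p -> {for p, continuous (qcoord l)}.
  by move=> _; exact: coord_continuous.
case: n => [|n]; first by split.
split=> // i; split=> [p _|];
  first exact: (@ex_derive _ _ _ _ _ _ _ (is_derive_coord _ _ _)).
apply: smooth_eq_on (smooth_cst _ n (qcoord l (qbasis i)) oO) => // p _.
by rewrite (@derive_val _ _ _ _ _ _ _ (is_derive_coord _ _ _)).
Qed.

Lemma smooth_of_Cn n Omega f l : open Omega -> Cn_on n Omega f ->
  smooth qbasis n Omega (fun p => qcoord l (f p)).
Proof.
move=> oO; elim: n f => [|n IH] f [cf df].
  by split=> // p Op; apply: continuous_comp (cf _ Op) _; exact: coord_continuous.
split=> [p Op|]; first by apply: continuous_comp (cf _ Op) _; exact: coord_continuous.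
have [df1 [c1 ci cj ck]] := df.
have sub v : (forall p, Omega p -> derivable f p v) -> Cn_on n Omega ('D_v f) ->
    (forall p, Omega p -> derivable (fun p => qcoord l (f p)) p v) /\
    smooth qbasis n Omega ('D_v (fun p => qcoord l (f p))).
  move=> dv cv; have dc p (Op : Omega p) := derivable_comp_coord l (dv p Op).
  split=> [p /dc [//]|]; apply: smooth_eq_on (IH _ cv) => // p /dc dcp.
  by rewrite (@derive_val _ _ _ _ _ _ _ dcp).
move=> [[|[|[|[|//]]]] k].
- exact (sub q1 (fun p Op => let: And4 d _ _ _ := df1 p Op in d) c1).
- exact (sub qi (fun p Op => let: And4 _ d _ _ := df1 p Op in d) ci).
- exact (sub qj (fun p Op => let: And4 _ _ d _ := df1 p Op in d) cj).
- exact (sub qk (fun p Op => let: And4 _ _ _ d := df1 p Op in d) ck).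
Qed.
End Coordinates.

(** * The first order system and its consequences of second order *)

Local Opaque q1 qi qj qk.

Section FueterSystem.
Context {R : realType}.
Implicit Types (p q v : quat R) (g u w : quat R -> R) (Omega : set (quat R)).

Definition real_laplacian g p : R :=
  'D_q1 ('D_q1 g) p + 'D_qi ('D_qi g) p + 'D_qj ('D_qj g) p + 'D_qk ('D_qk g) p.

(** The equation D_l (u + X w) = -2 w in real coordinates, X being the vector
    part of the quaternion.  On functions of t and r alone it reduces to the
    Cauchy-Riemann equations for u + i (r w) as a function of t + i r. *)
Definition fueter_system Omega u w := forall p, Omega p ->
  [/\ 'D_q1 u p = w p + (qx p * 'D_qi w p + qy p * 'D_qj w p + qz p * 'D_qk w p),
      'D_qi u p = qy p * 'D_qk w p - qz p * 'D_qj w p - qx p * 'D_q1 w p,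
      'D_qj u p = qz p * 'D_qi w p - qx p * 'D_qk w p - qy p * 'D_q1 w p &
      'D_qk u p = qx p * 'D_qj w p - qy p * 'D_qi w p - qz p * 'D_q1 w p].

Lemma derive_sum3 Omega (g h c1 c2 c3 a1 a2 a3 : quat R -> R) p v
    (d1 d2 d3 : R) : open Omega -> Omega p ->
  (forall q, Omega q -> g q = h q + (c1 q * a1 q + c2 q * a2 q + c3 q * a3 q)) ->
  is_derive p v c1 d1 -> is_derive p v c2 d2 -> is_derive p v c3 d3 ->
  derivable h p v -> derivable a1 p v -> derivable a2 p v -> derivable a3 p v ->
  'D_v g p = 'D_v h p + d1 * a1 p + d2 * a2 p + d3 * a3 p
    + c1 p * 'D_v a1 p + c2 p * 'D_v a2 p + c3 p * 'D_v a3 p.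
Proof.
move=> oO Op gE dc1 dc2 dc3 /derivableP dh.
move=> /derivableP da1 /derivableP da2 /derivableP da3.
have dE := is_deriveD dh (is_deriveD (is_deriveD (is_deriveM dc1 da1)
  (is_deriveM dc2 da2)) (is_deriveM dc3 da3)).
have [_ ->] := is_derive_eq_on oO gE Op dE.
rewrite /GRing.scale /=; ring.
Qed.

Lemma derive_sub3 Omega (g c1 c2 c3 a1 a2 a3 : quat R -> R) p v
    (d1 d2 d3 : R) : open Omega -> Omega p ->
  (forall q, Omega q -> g q = c1 q * a1 q - c2 q * a2 q - c3 q * a3 q) ->
  is_derive p v c1 d1 -> is_derive p v c2 d2 -> is_derive p v c3 d3 ->
  derivable a1 p v -> derivable a2 p v -> derivable a3 p v ->
  'D_v g p = d1 * a1 p - d2 * a2 p - d3 * a3 p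
    + c1 p * 'D_v a1 p - c2 p * 'D_v a2 p - c3 p * 'D_v a3 p.
Proof.
move=> oO Op gE dc1 dc2 dc3 /derivableP da1 /derivableP da2 /derivableP da3.
have dE := is_deriveB (is_deriveB (is_deriveM dc1 da1) (is_deriveM dc2 da2))
  (is_deriveM dc3 da3).
have [_ ->] := is_derive_eq_on oO gE Op dE.
rewrite /GRing.scale /=; ring.
Qed.

Lemma derive_fueter_system Omega u w p v : open Omega -> Omega p ->
  fueter_system Omega u w ->
  derivable w p v -> derivable ('D_q1 w) p v -> derivable ('D_qi w) p v ->
  derivable ('D_qj w) p v -> derivable ('D_qk w) p v ->
  [/\ 'D_v ('D_q1 u) p = 'D_v w p + qx v * 'D_qi w p + qy v * 'D_qj w p
        + qz v * 'D_qk w p + qx p * 'D_v ('D_qi w) p + qy p * 'D_v ('D_qj w) p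
        + qz p * 'D_v ('D_qk w) p,
      'D_v ('D_qi u) p =
        qy v * 'D_qk w p - qz v * 'D_qj w p - qx v * 'D_q1 w p
        + qy p * 'D_v ('D_qk w) p - qz p * 'D_v ('D_qj w) p
        - qx p * 'D_v ('D_q1 w) p,
      'D_v ('D_qj u) p =
        qz v * 'D_qi w p - qx v * 'D_qk w p - qy v * 'D_q1 w p
        + qz p * 'D_v ('D_qi w) p - qx p * 'D_v ('D_qk w) p
        - qy p * 'D_v ('D_q1 w) p &
      'D_v ('D_qk u) p =
        qx v * 'D_qj w p - qy v * 'D_qi w p - qz v * 'D_q1 w p
        + qx p * 'D_v ('D_qj w) p - qy p * 'D_v ('D_qi w) p
        - qz p * 'D_v ('D_q1 w) p].
Proof.
move=> oO Op sys dw dt dx dy dz.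
have [cx cy cz] := And3 (is_derive_qx p v) (is_derive_qy p v) (is_derive_qz p v).
split.
- apply: (derive_sum3 oO Op _ cx cy cz dw dx dy dz) => q Oq.
  by have [-> _ _ _] := sys q Oq.
- apply: (derive_sub3 oO Op _ cy cz cx dz dy dt) => q Oq.
  by have [_ -> _ _] := sys q Oq.
- apply: (derive_sub3 oO Op _ cz cx cy dx dz dt) => q Oq.
  by have [_ _ -> _] := sys q Oq.
- apply: (derive_sub3 oO Op _ cx cy cz dy dx dt) => q Oq.
  by have [_ _ _ ->] := sys q Oq.
Qed.

(** Linear algebra of the differentiated system, [U] and [W] being the Hessians
    of u and w, and [D] the gradient of w.  The diagonal entries of [U] add up to
    the first conclusion; for the others, e.g. the factor [x], subtract the two
    expressions of u_tx and add the difference of those of u_yz. *)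
Lemma fueter_elimination (U W : 'I_4 -> 'I_4 -> R) (D : 'I_4 -> R) (x y z : R) :
  (forall l m, U l m = U m l) -> (forall l m, W l m = W m l) ->
  (forall l,
   [/\ U l ot = D l + (l == ox)%:R * D ox + (l == oy)%:R * D oy
        + (l == oz)%:R * D oz + x * W l ox + y * W l oy + z * W l oz,
      U l ox = (l == oy)%:R * D oz - (l == oz)%:R * D oy - (l == ox)%:R * D ot
        + y * W l oz - z * W l oy - x * W l ot,
      U l oy = (l == oz)%:R * D ox - (l == ox)%:R * D oz - (l == oy)%:R * D ot
        + z * W l ox - x * W l oz - y * W l ot &
      U l oz = (l == ox)%:R * D oy - (l == oy)%:R * D ox - (l == oz)%:R * D ot
        + x * W l oy - y * W l ox - z * W l ot]) ->
  let LW := W ot ot + W ox ox + W oy oy + W oz oz in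
  [/\ U ot ot + U ox ox + U oy oy + U oz oz = - 2 * D ot,
      x * LW = 0, y * LW = 0 & z * LW = 0].
Proof.
move=> symU symW H LW; rewrite /LW.
have [] := H ot; have [] := H ox; have [] := H oy; have [] := H oz.
rewrite /eqtype.eq_op /=.
rewrite (symU ox ot) (symU oy ot) (symU oz ot) (symU oy ox) (symU oz ox) (symU oz oy).
rewrite (symW ox ot) (symW oy ot) (symW oz ot) (symW oy ox) (symW oz ox) (symW oz oy).
move: (U ot ot) (U ox ox) (U oy oy) (U oz oz) (U ot ox) (U ot oy) (U ot oz)
  (U ox oy) (U ox oz) (U oy oz).
move: (W ot ot) (W ox ox) (W oy oy) (W oz oz) (W ot ox) (W ot oy) (W ot oz)
  (W ox oy) (W ox oz) (W oy oz) (D ot) (D ox) (D oy) (D oz).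
clear=> wtt wxx wyy wzz wtx wty wtz wxy wxz wyz a b c d.
move=> utt uxx uyy uzz utx uty utz uxy uxz uyz.
move=> z0 z1 z2 z3 y0 y1 y2 y3 x0 x1 x2 x3 t0 t1 t2 t3.
split; lra.
Qed.

Lemma laplacians_of_fueter_system Omega u w : open Omega ->
  Omega `<=` ~` real_axis -> smooth qbasis 2 Omega u -> smooth qbasis 2 Omega w ->
  fueter_system Omega u w ->
  forall p, Omega p -> real_laplacian u p = - 2 * 'D_q1 w p /\ real_laplacian w p = 0.
Proof.
move=> oO axis su sw sys p Op.
have H l := derive_fueter_system oO Op sys ((sw.2 l).1 _ Op)
  (((sw.2 ot).2.2 l).1 _ Op) (((sw.2 ox).2.2 l).1 _ Op)
  (((sw.2 oy).2.2 l).1 _ Op) (((sw.2 oz).2.2 l).1 _ Op).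
have := @fueter_elimination (fun l m => 'D_(qbasis l) ('D_(qbasis m) u) p)
  (fun l m => 'D_(qbasis l) ('D_(qbasis m) w) p) (fun l => 'D_(qbasis l) w p)
  (qx p) (qy p) (qz p) (fun l m => smooth2_schwarz m l oO su Op)
  (fun l m => smooth2_schwarz m l oO sw Op).
have cE := @qbasis_indicator R.
case=> [l|lu lx ly lz].
  by have [<- <- <-] := cE l; exact: H.
split; first exact: lu.
have nax : ~ (qx p = 0 /\ qy p = 0 /\ qz p = 0).
  by move=> [ex [ey ez]]; exact: (axis p Op (And3 ex ey ez)).
move: lx ly lz nax; rewrite /real_laplacian.
move: (_ + _ + _ + _) (qx p) (qy p) (qz p) => L x y z lx ly lz nax.
apply: contrapT => /eqP /negPf l0; apply: nax; split; [|split]; apply/eqP.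
- by move/eqP: lx; rewrite mulf_eq0 l0 orbF.
- by move/eqP: ly; rewrite mulf_eq0 l0 orbF.
- by move/eqP: lz; rewrite mulf_eq0 l0 orbF.
Qed.
End FueterSystem.

(** * Regularity of the conjugate gradient of a harmonic function *)

Section FueterOperators.
Context {R : realType}.
Implicit Types (p q v : quat R) (f g : quat R -> quat R) (w : quat R -> R)
  (Omega : set (quat R)).

Lemma coord_derive f p v : derivable f p v ->
  [/\ 'D_v (fun q => qt (f q)) p = qt ('D_v f p),
      'D_v (fun q => qx (f q)) p = qx ('D_v f p),
      'D_v (fun q => qy (f q)) p = qy ('D_v f p) &
      'D_v (fun q => qz (f q)) p = qz ('D_v f p)].
Proof.
move=> df; have H l := @derive_val _ _ _ _ _ _ _ (derivable_comp_coord l df).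
split.
- exact: (H ot).
- exact: (H ox).
- exact: (H oy).
- exact: (H oz).
Qed.

Lemma regular_eq_on Omega f g p : open Omega -> (forall q, Omega q -> f q = g q) ->
  Omega p -> has_partials g p ->
  [/\ has_partials f p, Dleft f p = Dleft g p & Dright f p = Dright g p].
Proof.
move=> oO fg Op [dt dx dy dz].
have H v (dv : derivable g p v) := is_derive_eq_on oO fg Op (derivableP dv).
have [[d1 e1] [d2 e2]] := (H _ dt, H _ dx).
have [[d3 e3] [d4 e4]] := (H _ dy, H _ dz).
split; first exact (And4 d1 d2 d3 d4).
- by rewrite /Dleft e1 e2 e3 e4.
- by rewrite /Dright e1 e2 e3 e4.
Qed.

(** This is -2 conj(D) w, where conj(D) = d/dt - i d/dx - j d/dy - k d/dz. *)
Definition conj_gradient w p : quat R :=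
  mkquat (- 2 * 'D_q1 w p) (2 * 'D_qi w p) (2 * 'D_qj w p) (2 * 'D_qk w p).

Lemma is_derive_mkquat (a b c d : quat R -> R) p v (a' b' c' d' : R) :
  is_derive p v a a' -> is_derive p v b b' ->
  is_derive p v c c' -> is_derive p v d d' ->
  is_derive p v (fun q => mkquat (a q) (b q) (c q) (d q)) (mkquat a' b' c' d').
Proof.
move=> [da ea] [db eb] [dc ec] [dd ed].
set g := fun q => _.
have gE l : (fun q => qcoord l (g q)) = [:: a; b; c; d]`_l.
  by apply/funext => q; rewrite /qcoord mxE; move: l => [[|[|[|[|//]]]] k].
have dg : derivable g p v.
  apply: derivable_quat => l; rewrite gE; move: l => [[|[|[|[|l]]]] k].
  - exact: da.
  - exact: db.
  - exact: dc.
  - exact: dd.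
  - by case: (notF k).
split; first exact: dg.
apply/rowP => l; rewrite [RHS]mxE.
have [_ gl] := derivable_comp_coord l dg; apply: etrans (esym gl) _.
rewrite gE {gl}; move: l => [[|[|[|[|l]]]] k].
- exact: ea.
- exact: eb.
- exact: ec.
- exact: ed.
- by case: (notF k).
Qed.

(** D conj(D) = conj(D) D = Lap, for the Hessian [W] of a real function: the
    vector parts cancel by symmetry and the real parts are multiples of the
    trace. *)
Lemma conj_gradient_elimination (W : 'I_4 -> 'I_4 -> R)
    (a := fun l => mkquat (- 2 * W l ot) (2 * W l ox) (2 * W l oy) (2 * W l oz)) :
  (forall l m, W l m = W m l) -> W ot ot + W ox ox + W oy oy + W oz oz = 0 ->
  a ot + qmul qi (a ox) + qmul qj (a oy) + qmul qk (a oz) = 0 /\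
  a ot + qmul (a ox) qi + qmul (a oy) qj + qmul (a oz) qk = 0.
Proof.
move=> symW lap0; rewrite /a.
have z0 : [/\ @qt R 0 = 0, @qx R 0 = 0, @qy R 0 = 0 & @qz R 0 = 0].
  by rewrite /qt /qx /qy /qz !mxE.
have [zt zx zy zz] := z0.
rewrite (symW ox ot) (symW oy ot) (symW oz ot) (symW oy ox) (symW oz ox) (symW oz oy).
split; apply: quatP; rewrite !(quat_linE, mkquatE) ?qbasis_coordE
  ?zt ?zx ?zy ?zz; lra.
Qed.

Lemma conj_gradient_regular Omega w p : open Omega -> smooth qbasis 2 Omega w ->
  Omega p -> real_laplacian w p = 0 ->
  [/\ has_partials (conj_gradient w) p, Dleft (conj_gradient w) p = 0 &
    Dright (conj_gradient w) p = 0].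
Proof.
move=> oO sw Op lap0.
have dG l : is_derive p (qbasis l) (conj_gradient w)
    (mkquat (- 2 * 'D_(qbasis l) ('D_q1 w) p) (2 * 'D_(qbasis l) ('D_qi w) p)
            (2 * 'D_(qbasis l) ('D_qj w) p) (2 * 'D_(qbasis l) ('D_qk w) p)).
  have dw m : is_derive p (qbasis l) ('D_(qbasis m) w)
      ('D_(qbasis l) ('D_(qbasis m) w) p).
    exact: derivableP (((sw.2 m).2.2 l).1 _ Op).
  exact: is_derive_mkquat (is_deriveZ (- 2) (dw ot)) (is_deriveZ 2 (dw ox))
    (is_deriveZ 2 (dw oy)) (is_deriveZ 2 (dw oz)).
have [d0 e0] : is_derive p q1 (conj_gradient w) _ := dG ot.
have [d1 e1] : is_derive p qi (conj_gradient w) _ := dG ox.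
have [d2 e2] : is_derive p qj (conj_gradient w) _ := dG oy.
have [d3 e3] : is_derive p qk (conj_gradient w) _ := dG oz.
have [le re] := conj_gradient_elimination
  (W := fun l m => 'D_(qbasis l) ('D_(qbasis m) w) p)
  (fun l m => smooth2_schwarz m l oO sw Op) lap0.
split; first exact (And4 d0 d1 d2 d3).
- by rewrite /Dleft e0 e1 e2 e3; exact: le.
- by rewrite /Dright e0 e1 e2 e3; exact: re.
Qed.

(** * The Laplacian in coordinates *)

Lemma laplacian_comp_coord Omega f p l : open Omega -> Cn_on 2 Omega f -> Omega p ->
  qcoord l (laplacian f p) = real_laplacian (fun q => qcoord l (f q)) p.
Proof.
move=> oO [_ [df [[_ [d0 _]] [_ [d1 _]] [_ [d2 _]] [_ [d3 _]]]]] Op.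
have H v : (forall q, Omega q -> derivable f q v) -> derivable ('D_v f) p v ->
    'D_v ('D_v (fun q => qcoord l (f q))) p = qcoord l ('D_v ('D_v f) p).
  move=> dv dvv.
  apply: (@derive_val _ _ _ _ _ _ _ (is_derive_eq_on oO _ Op
    (derivable_comp_coord l dvv))) => q Oq.
  exact: (@derive_val _ _ _ _ _ _ _ (derivable_comp_coord l (dv q Oq))).
have [a0 _ _ _] := d0 p Op; have [_ a1 _ _] := d1 p Op.
have [_ _ a2 _] := d2 p Op; have [_ _ _ a3] := d3 p Op.
have E0 := H _ (fun q Oq => let: And4 a _ _ _ := df q Oq in a) a0.
have E1 := H _ (fun q Oq => let: And4 _ a _ _ := df q Oq in a) a1.
have E2 := H _ (fun q Oq => let: And4 _ _ a _ := df q Oq in a) a2.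
have E3 := H _ (fun q Oq => let: And4 _ _ _ a := df q Oq in a) a3.
have add := congr2 (@GRing.add R).
apply: etrans (esym (add _ _ _ _ (add _ _ _ _ (add _ _ _ _ E0 E1) E2) E3)).
by rewrite /laplacian /qcoord !mxE.
Qed.

(** A coordinate function has constant derivatives, so that only the cross terms
    of Leibniz' rule are left besides the Laplacian of w. *)
Lemma real_laplacian_coordM Omega (g w : quat R -> R) p l : open Omega ->
  smooth qbasis 2 Omega w -> (forall q, Omega q -> g q = qcoord l q * w q) ->
  Omega p -> real_laplacian g p = qcoord l p * real_laplacian w p
   + 2 * (qcoord l q1 * 'D_q1 w p + qcoord l qi * 'D_qi w p
          + qcoord l qj * 'D_qj w p + qcoord l qk * 'D_qk w p).
Proof.
move=> oO sw gE Op.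
have H m : 'D_(qbasis m) ('D_(qbasis m) g) p =
   qcoord l p * 'D_(qbasis m) ('D_(qbasis m) w) p
   + 2 * (qcoord l (qbasis m) * 'D_(qbasis m) w p).
  have [dw [_ ddw]] := sw.2 m; have [dww _] := ddw m.
  have dg q (Oq : Omega q) : 'D_(qbasis m) g q =
      qcoord l q * 'D_(qbasis m) w q + w q * qcoord l (qbasis m).
    exact: (@derive_val _ _ _ _ _ _ _ (is_derive_eq_on oO gE Oq
      (is_deriveM (is_derive_coord l q _) (derivableP (dw _ Oq))))).
  have cc := is_derive_cst (qcoord l (qbasis m)) p (qbasis m).
  have [_ ->] := is_derive_eq_on oO dg Op (is_deriveD
     (is_deriveM (is_derive_coord l p _) (derivableP (dww _ Op)))
     (is_deriveM (derivableP (dw _ Op)) cc)).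
  rewrite /GRing.scale /=; ring.
have add := congr2 (@GRing.add R).
apply: etrans (add _ _ _ _ (add _ _ _ _ (add _ _ _ _ (H ot) (H ox)) (H oy)) (H oz)) _.
have factor (c a0 a1 a2 a3 b0 b1 b2 b3 : R) :
    c * a0 + 2 * b0 + (c * a1 + 2 * b1) + (c * a2 + 2 * b2) + (c * a3 + 2 * b3)
    = c * (a0 + a1 + a2 + a3) + 2 * (b0 + b1 + b2 + b3) by ring.
exact: factor.
Qed.

(** * Reduction of the Fueter equation to the first order system *)

(** Equals v / r when f = u + iota v, but written without square roots, and
    from the components of f alone: its smoothness follows from that of f
    by the algebra of smooth functions. *)
Definition radial_quotient f p : R :=
  (qx p * qx (f p) + qy p * qy (f p) + qz p * qz (f p))
  / (qx p ^+ 2 + qy p ^+ 2 + qz p ^+ 2).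

Lemma sqr_norm_neq0 p : ~ real_axis p -> qx p ^+ 2 + qy p ^+ 2 + qz p ^+ 2 != 0.
Proof.
move=> axis; apply/eqP => s0; apply: axis; rewrite /real_axis /=.
have [x0 y0 z0] := And3 (sqr_ge0 (qx p)) (sqr_ge0 (qy p)) (sqr_ge0 (qz p)).
have sq0 (a : R) : a ^+ 2 <= 0 -> a = 0.
  by move=> a0; apply/eqP; rewrite -sqrf_eq0 eq_le a0 sqr_ge0.
by split; apply: sq0; lra.
Qed.

Lemma smooth_radial_quotient n Omega f : open Omega -> Omega `<=` ~` real_axis ->
  Cn_on n Omega f -> smooth qbasis n Omega (radial_quotient f).
Proof.
move=> oO axis cf.
have sc l := smooth_coord (R := R) n l oO.
have sf l := smooth_of_Cn l oO cf.
have sM (a b : quat R -> R) := @smoothM _ _ _ qbasis n Omega a b oO.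
have sD (a b : quat R -> R) := @smoothD _ _ _ qbasis n Omega a b oO.
have sN := sD _ _ (sD _ _ (sM _ _ (sc ox) (sc ox)) (sM _ _ (sc oy) (sc oy)))
  (sM _ _ (sc oz) (sc oz)).
have sX := sD _ _ (sD _ _ (sM _ _ (sc ox) (sf ox)) (sM _ _ (sc oy) (sf oy)))
  (sM _ _ (sc oz) (sf oz)).
apply: sM sX (smoothV oO _ _).
  by move=> p /axis /sqr_norm_neq0.
exact: sN.
Qed.
End FueterOperators.

Section Decomposition.
Context {R : realType}.
Implicit Types (p q : quat R) (f : quat R -> quat R) (u v : quat R -> R)
  (Omega : set (quat R)).

Lemma radial_quotientP p (f : quat R -> quat R) (a b : R) : ~ real_axis p ->
  f p = qreal a + qmul (qiota p) (qreal b) ->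
  [/\ qx (f p) = qx p * radial_quotient f p,
      qy (f p) = qy p * radial_quotient f p,
      qz (f p) = qz p * radial_quotient f p & radial_quotient f p = b / qr p].
Proof.
move=> /sqr_norm_neq0 s0 fE.
have r2 : qr p ^+ 2 = qx p ^+ 2 + qy p ^+ 2 + qz p ^+ 2.
  by rewrite sqr_sqrtr// !addr_ge0 ?sqr_ge0.
have r0 : qr p != 0 by rewrite -sqrf_eq0 r2.
have [ex ey ez] : [/\ qx (f p) = qx p * (b / qr p), qy (f p) = qy p * (b / qr p) &
   qz (f p) = qz p * (b / qr p)].
  rewrite fE /qiota; split; rewrite !(quat_linE, mkquatE) ?qbasis_coordE; ring.
have E : radial_quotient f p = b / qr p.
  rewrite /radial_quotient ex ey ez -r2.
  have -> : qx p * (qx p * (b / qr p)) + qy p * (qy p * (b / qr p))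
    + qz p * (qz p * (b / qr p)) = qr p ^+ 2 * (b / qr p) by rewrite r2; ring.
  by rewrite mulrAC divff ?mul1r// sqrf_eq0.
by rewrite E.
Qed.

(** [a l] is the partial derivative of f = u + X c in the direction [l], where
    [U] and [W] are the gradients of u and of the real factor of X, and [c] is
    the value of that factor. *)
Lemma Dleft_components (U W : 'I_4 -> R) (x y z c : R)
    (a := fun l => mkquat (U l) (x * W l + c * (l == ox)%:R)
       (y * W l + c * (l == oy)%:R) (z * W l + c * (l == oz)%:R)) :
  a ot + qmul qi (a ox) + qmul qj (a oy) + qmul qk (a oz) = qreal (- 2 * c) ->
  [/\ U ot = c + (x * W ox + y * W oy + z * W oz),
      U ox = y * W oz - z * W oy - x * W ot,
      U oy = z * W ox - x * W oz - y * W ot &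
      U oz = x * W oy - y * W ox - z * W ot].
Proof.
move=> aE; have at_ := congr1 (@qt R) aE; have ax := congr1 (@qx R) aE.
have ay := congr1 (@qy R) aE; have az := congr1 (@qz R) aE.
move: at_ ax ay az; rewrite /a /eqtype.eq_op /= !(quat_linE, mkquatE) ?qbasis_coordE.
by move=> et ex ey ez; split; lra.
Qed.

Lemma fueter_system_of_Dleft Omega f w : open Omega -> Cn_on 2 Omega f ->
  smooth qbasis 2 Omega w ->
  (forall p, Omega p ->
    [/\ qx (f p) = qx p * w p, qy (f p) = qy p * w p & qz (f p) = qz p * w p]) ->
  (forall p, Omega p -> Dleft f p = qreal (- 2 * w p)) ->
  fueter_system Omega (fun p => qt (f p)) w.
Proof.
move=> oO [_ [hf _]] sw fE Df p Op.
have cE := @qbasis_indicator R.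
have dE l : derivable f p (qbasis l) -> 'D_(qbasis l) f p =
    mkquat ('D_(qbasis l) (fun p => qt (f p)) p)
    (qx p * 'D_(qbasis l) w p + w p * (l == ox)%:R)
    (qy p * 'D_(qbasis l) w p + w p * (l == oy)%:R)
    (qz p * 'D_(qbasis l) w p + w p * (l == oz)%:R).
  move=> /coord_derive[et ex ey ez]; have [<- <- <-] := cE l.
  have dw := derivableP ((sw.2 l).1 _ Op).
  apply: quatP; rewrite mkquatE; first exact: esym et.
  - apply: etrans (esym ex) _.
    have gE q (Oq : Omega q) : qx (f q) = qx q * w q by have [] := fE q Oq.
    by have [_] := is_derive_eq_on oO gE Op (is_deriveM (is_derive_qx p _) dw).
  - apply: etrans (esym ey) _.
    have gE q (Oq : Omega q) : qy (f q) = qy q * w q by have [] := fE q Oq.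
    by have [_] := is_derive_eq_on oO gE Op (is_deriveM (is_derive_qy p _) dw).
  - apply: etrans (esym ez) _.
    have gE q (Oq : Omega q) : qz (f q) = qz q * w q by have [] := fE q Oq.
    by have [_] := is_derive_eq_on oO gE Op (is_deriveM (is_derive_qz p _) dw).
have [d0 d1 d2 d3] := hf p Op.
have E0 : 'D_q1 f p = _ := dE ot d0.
have E1 : 'D_qi f p = _ := dE ox d1.
have E2 : 'D_qj f p = _ := dE oy d2.
have E3 : 'D_qk f p = _ := dE oz d3.
have := Df p Op; rewrite /Dleft E0 E1 E2 E3.
exact: (@Dleft_components (fun l => 'D_(qbasis l) (fun p => qt (f p)) p)
  (fun l => 'D_(qbasis l) w p)).
Qed.

Lemma laplacian_conj_gradient Omega f w p : open Omega -> Cn_on 2 Omega f ->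
  smooth qbasis 2 Omega w -> Omega p ->
  (forall p, Omega p ->
    [/\ qx (f p) = qx p * w p, qy (f p) = qy p * w p & qz (f p) = qz p * w p]) ->
  real_laplacian (fun p => qt (f p)) p = - 2 * 'D_q1 w p ->
  real_laplacian w p = 0 ->
  laplacian f p = conj_gradient w p.
Proof.
move=> oO cf sw Op fE lu lw.
have L l := laplacian_comp_coord l oO cf Op.
have gx q (Oq : Omega q) : qx (f q) = qx q * w q by have [] := fE q Oq.
have gy q (Oq : Omega q) : qy (f q) = qy q * w q by have [] := fE q Oq.
have gz q (Oq : Omega q) : qz (f q) = qz q * w q by have [] := fE q Oq.
have X := real_laplacian_coordM (l := ox) oO sw gx Op.
have Y := real_laplacian_coordM (l := oy) oO sw gy Op.
have Z := real_laplacian_coordM (l := oz) oO sw gz Op.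
have rest (c e0 e1 e2 e3 a0 a1 a2 a3 : R) : c * real_laplacian w p
  + 2 * (e0 * a0 + e1 * a1 + e2 * a2 + e3 * a3)
  = 2 * (e0 * a0 + e1 * a1 + e2 * a2 + e3 * a3) by rewrite lw mulr0 add0r.
have [x0 x1 x2 x3] : [/\ @qx R q1 = 0, @qx R qi = 1, @qx R qj = 0 & @qx R qk = 0].
  by rewrite !qbasis_coordE.
have [y0 y1 y2 y3] : [/\ @qy R q1 = 0, @qy R qi = 0, @qy R qj = 1 & @qy R qk = 0].
  by rewrite !qbasis_coordE.
have [z0 z1 z2 z3] : [/\ @qz R q1 = 0, @qz R qi = 0, @qz R qj = 0 & @qz R qk = 1].
  by rewrite !qbasis_coordE.
apply: quatP; rewrite mkquatE.
- by apply: etrans (L ot) _; exact: lu.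
- apply: etrans (L ox) (etrans X (etrans (rest _ _ _ _ _ _ _ _ _) _)).
  by rewrite -[qcoord ox]/(@qx R) x0 x1 x2 x3 !mul0r mul1r add0r !addr0.
- apply: etrans (L oy) (etrans Y (etrans (rest _ _ _ _ _ _ _ _ _) _)).
  by rewrite -[qcoord oy]/(@qy R) y0 y1 y2 y3 !mul0r mul1r !add0r !addr0.
- apply: etrans (L oz) (etrans Z (etrans (rest _ _ _ _ _ _ _ _ _) _)).
  by rewrite -[qcoord oz]/(@qz R) z0 z1 z2 z3 !mul0r mul1r !add0r.
Qed.
End Decomposition.

Theorem theorem1 (R : realType) (Omega : set (quat R))
    (f : quat R -> quat R) (u v : quat R -> R) :
  open Omega ->
  Omega `<=` ~` real_axis ->
  Cn_on 2 Omega f ->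
  (forall p, Omega p -> f p = qreal (u p) + qmul (qiota p) (qreal (v p))) ->
  (forall p, Omega p -> Dleft f p = qreal (- 2 * v p / qr p)) ->
  left_regular Omega (laplacian f) /\ right_regular Omega (laplacian f).
Proof.
move=> oO axis cf fE Df; pose w := radial_quotient f.
have sw : smooth qbasis 2 Omega w by exact: smooth_radial_quotient.
have fw p (Op : Omega p) := radial_quotientP (axis p Op) (fE p Op).
have fxyz p (Op : Omega p) : [/\ qx (f p) = qx p * w p, qy (f p) = qy p * w p &
    qz (f p) = qz p * w p] by have [] := fw p Op.
have Dw p (Op : Omega p) : Dleft f p = qreal (- 2 * w p).
  by have [_ _ _ wE] := fw p Op; rewrite Df// /w wE mulrA.
have sys := fueter_system_of_Dleft oO cf sw fxyz Dw.
have lap := laplacians_of_fueter_system oO axis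
  (smooth_of_Cn ot oO cf) sw sys.
have lapE q (Oq : Omega q) : laplacian f q = conj_gradient w q.
  by have [lu lw] := lap q Oq; exact: laplacian_conj_gradient sw Oq fxyz lu lw.
have reg p (Op : Omega p) : [/\ has_partials (laplacian f) p,
    Dleft (laplacian f) p = 0 & Dright (laplacian f) p = 0].
  have [hG GL GR] := conj_gradient_regular oO sw Op (lap p Op).2.
  by have [hp -> ->] := regular_eq_on oO lapE Op hG.
by split=> p /reg[].
Qed.
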